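(* Let $p$ be a prime and let $A$ be an abelian $p$-group. Then the Liebert topology $\mathcal{T}_L$ on $\mathrm{End} A$ is admissible.
   Context: For $n\in\mathbb{N}$ put $A_n=A[p^n]=\{a\in A\mid p^na=0\}$ and $T(A_n)=\{\alpha\in \mathrm{End} A\mid \alpha A_n=0\}$. The Liebert topology $\mathcal{T}_L$ on $\mathrm{End} A$ is the ring topology having the family $\{T(A_n)\}_{n\in\mathbb{N}}$ as a fundamental system of neighborhoods of zero. The finite topology $\mathcal{T}_{fin}$ on $\mathrm{End} A$ has as a fundamental system of neighborhoods of zero the sets $T(K)=\{\alpha\in \mathrm{End} A\mid \alpha K=0\}$, $K$ running over all finite subsets of $A$. A ring topology $\mathcal{T}$ on $\mathrm{End} A$ is called admissible if $\mathcal{T}\geq\mathcal{T}_{fin}$, i.e. every $\mathcal{T}_{fin}$-open set is $\mathcal{T}$-open. *)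

(* Defs.v *)
From HB Require Import structures.
From mathcomp Require Import all_boot all_algebra.
From mathcomp Require Import all_classical topology.

Set Implicit Arguments.
Unset Strict Implicit.
Unset Printing Implicit Defensive.

Import GRing.Theory.
Local Open Scope classical_set_scope.
Local Open Scope ring_scope.

Definition endo (A : zmodType) : Type := {additive A -> A}.

Definition endo_fun (A : zmodType) (f : endo A) : A -> A := f.
Coercion endo_fun : endo >-> Funclass.

Section EndoRing.
Variable A : zmodType.

HB.instance Definition _ := gen_eqMixin (endo A).
HB.instance Definition _ := gen_choiceMixin (endo A).

Lemma endo_ext (f g : endo A) : (forall a, f a = g a) -> f = g.
Proof.
move: f g => [f [[Hf]]] [g [[Hg]]] /= fg.
have {}fg : f = g by apply/funext.
by case: _ / fg Hg => Hg; rewrite (Prop_irrelevance Hf Hg).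
Qed.

Let zeroE : endo A := (\0 : {additive A -> A}).
Let addE (f g : endo A) : endo A :=
  ((f : {additive A -> A}) \+ (g : {additive A -> A}) : {additive A -> A}).
Let oppE (f : endo A) : endo A :=
  (\- (f : {additive A -> A}) : {additive A -> A}).
Let oneE : endo A := (idfun : {additive A -> A}).
Let mulE (f g : endo A) : endo A :=
  ((f : {additive A -> A}) \o (g : {additive A -> A}) : {additive A -> A}).

Let addEA : associative addE.
Proof. by move=> f g h; apply: endo_ext => a /=; exact: addrA. Qed.
Let addEC : commutative addE.
Proof. by move=> f g; apply: endo_ext => a /=; exact: addrC. Qed.
Let add0E : left_id zeroE addE.
Proof. by move=> f; apply: endo_ext => a /=; exact: add0r. Qed.
Let addNE : left_inverse zeroE oppE addE.
Proof. by move=> f; apply: endo_ext => a /=; exact: addNr. Qed.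

HB.instance Definition _ :=
  GRing.isZmodule.Build (endo A) addEA addEC add0E addNE.

Let mulEA : associative mulE.
Proof. by move=> f g h; apply: endo_ext. Qed.
Let mul1E : left_id oneE mulE.
Proof. by move=> f; apply: endo_ext. Qed.
Let mulE1 : right_id oneE mulE.
Proof. by move=> f; apply: endo_ext. Qed.
Let mulEDl : left_distributive mulE addE.
Proof. by move=> f g h; apply: endo_ext. Qed.
Let mulEDr : right_distributive mulE addE.
Proof.
move=> f g h; apply: endo_ext => a.
exact: (raddfD (f : {additive A -> A})).
Qed.

(* [pzRingType] rather than [nzRingType]: [endo A] is the zero ring if A = 0. *)
HB.instance Definition _ := GRing.Zmodule_isPzRing.Build (endo A)
  mulEA mul1E mulE1 mulEDl mulEDr.

Lemma endo0E (a : A) : (0 : endo A) a = 0. Proof. by []. Qed.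
Lemma endoDE (f g : endo A) (a : A) : (f + g : endo A) a = f a + g a.
Proof. by []. Qed.
Lemma endoNE (f : endo A) (a : A) : (- f : endo A) a = - f a. Proof. by []. Qed.
Lemma endoBE (f g : endo A) (a : A) : (f - g : endo A) a = f a - g a.
Proof. by []. Qed.
Lemma endo1E (a : A) : (1 : endo A) a = a. Proof. by []. Qed.
Lemma endoME (f g : endo A) (a : A) : (f * g : endo A) a = f (g a). Proof. by []. Qed.

End EndoRing.

Definition p_group (p : nat) (A : zmodType) : Prop :=
  forall a : A, exists n : nat, a *+ (p ^ n) = 0.

(* A[m] *)
Definition torsion (A : zmodType) (m : nat) : set A := [set a | a *+ m = 0].
Arguments torsion : clear implicits.

(* T(S) *)
Definition annihilator (A : zmodType) (S : set A) : set (endo A) :=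
  [set f | forall a, S a -> f a = 0].

(* The translates f + T(S i), i in D, generate the neighborhoods of f. *)
Section AnnihilatorNbhs.
Variables (A : zmodType) (I : Type) (D : set I) (S : I -> set A).

Definition annihilator_nbhs (f : endo A) : set_system (endo A) :=
  filter_from D (fun i => [set g | annihilator (S i) (g - f)]).

Hypothesis D_nonempty : D !=set0.
Hypothesis S_directed : forall i j, D i -> D j ->
  exists2 k, D k & S i `|` S j `<=` S k.

Lemma annihilator_nbhs_filter f : ProperFilter (annihilator_nbhs f).
Proof.
apply: filter_from_proper => [|i _]; last first.
  by exists f => a _; rewrite subrr.
apply: filter_from_filter => // i j Di Dj.
have [k Dk Sk] := S_directed Di Dj; exists k => // g gf.
by split=> a Sa; apply: gf; apply: Sk; [left|right].
Qed.

Lemma annihilator_nbhs_singleton f (U : set (endo A)) :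
  annihilator_nbhs f U -> U f.
Proof. by move=> [i _]; apply=> a _; rewrite subrr. Qed.

Lemma annihilator_nbhs_nbhs f (U : set (endo A)) :
  annihilator_nbhs f U -> annihilator_nbhs f (annihilator_nbhs^~ U).
Proof.
move=> [i Di iU]; exists i => // g gf; exists i => // h hg; apply: iU => a Sa.
by rewrite -(subrKA g) endoDE hg// gf// addr0.
Qed.

Lemma annihilator_nbhs0 :
  annihilator_nbhs 0 = filter_from D (fun i => annihilator (S i)).
Proof.
by apply/seteqP; split=> U [i Di iU]; exists i => // g /=;
  have := iU g; rewrite /= subr0.
Qed.

End AnnihilatorNbhs.

Section LiebertTopology.
Variables (p : nat) (A : zmodType).

Definition liebert_space : Type := endo A.

Let torsion_directed (i j : nat) : [set: nat] i -> [set: nat] j ->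
  exists2 k, [set: nat] k &
    torsion A (p ^ i) `|` torsion A (p ^ j) `<=` torsion A (p ^ k).
Proof.
move=> _ _; exists (i + j)%N => // a; rewrite /torsion /= expnD.
by case=> ai; rewrite ?mulrnA ?ai ?mul0rn// mulrnAC ai mul0rn.
Qed.

Let setT_nat_nonempty : [set: nat] !=set0. Proof. by exists 0%N. Qed.

HB.instance Definition _ := Choice.on liebert_space.
HB.instance Definition _ := hasNbhs.Build liebert_space
  (annihilator_nbhs [set: nat] (fun n => torsion A (p ^ n))).
HB.instance Definition _ := Nbhs_isNbhsTopological.Build liebert_space
  (annihilator_nbhs_filter setT_nat_nonempty torsion_directed)
  (@annihilator_nbhs_singleton _ _ _ _) (@annihilator_nbhs_nbhs _ _ _ _).

Definition liebert_topology : Topological (endo A) :=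
  Topological.class liebert_space.

End LiebertTopology.

Section FiniteTopology.
Variable A : zmodType.

Definition finite_space : Type := endo A.

Let finite_directed (K L : set A) : finite_set K -> finite_set L ->
  exists2 M, finite_set M & K `|` L `<=` M.
Proof. by move=> Kf Lf; exists (K `|` L) => //; rewrite finite_setU. Qed.

Let finite_nonempty : @finite_set A !=set0. Proof. by exists set0. Qed.

HB.instance Definition _ := Choice.on finite_space.
HB.instance Definition _ := hasNbhs.Build finite_space
  (annihilator_nbhs (@finite_set A) id).
HB.instance Definition _ := Nbhs_isNbhsTopological.Build finite_space
  (annihilator_nbhs_filter finite_nonempty finite_directed)
  (@annihilator_nbhs_singleton _ _ _ _) (@annihilator_nbhs_nbhs _ _ _ _).

Definition finite_topology : Topological (endo A) :=
  Topological.class finite_space.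

End FiniteTopology.

(* [Topological X] is the type of topologies on the carrier X. *)

Lemma liebert_topology_nbhs0 (p : nat) (A : zmodType) :
  @nbhs _ (Topological.Pack (liebert_topology p A)) (0 : endo A) =
  filter_from [set: nat] (fun n => annihilator (torsion A (p ^ n))).
Proof. exact: annihilator_nbhs0. Qed.

Lemma finite_topology_nbhs0 (A : zmodType) :
  @nbhs _ (Topological.Pack (finite_topology A)) (0 : endo A) =
  filter_from (@finite_set A) (@annihilator A).
Proof. exact: annihilator_nbhs0. Qed.

Definition ring_topology (R : pzRingType) (tau : Topological R) : Prop :=
  let X : topologicalType := Topological.Pack tau in
  [/\ continuous (fun xy : X * X => (xy.1 : R) + (xy.2 : R) : X),
      continuous (fun x : X => - (x : R) : X)
    & continuous (fun xy : X * X => (xy.1 : R) * (xy.2 : R) : X)].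

(* tau >= sigma *)
Definition finer_topology (X : Type) (tau sigma : Topological X) : Prop :=
  @open (Topological.Pack sigma) `<=` @open (Topological.Pack tau).

Definition admissible (A : zmodType) (tau : Topological (endo A)) : Prop :=
  ring_topology tau /\ finer_topology tau (finite_topology A).

(* Main.v *)
Require Import Defs.
From mathcomp Require Import all_boot all_algebra.
From mathcomp Require Import all_classical topology.

(** Addition and negation are continuous because each [T(A_n)] is an additive
    subgroup.  Multiplication is continuous because [A_n] is fully invariant
    ([torsion_endo]): if [f'] and [g'] agree with [f] and [g] on [A_n], then
    [f' g' - f g = f' (g' - g) + (f' - f) g] vanishes on [A_n], the second
    summand because [g] maps [A_n] into itself.  Hence the same [n] serves for
    both factors.

    The topology is finer than the finite one because the [A_n] form an
    increasing chain which, [A] being a [p]-group, exhausts [A].  So a finite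
    set [K] lies in a single [A_n] ([finite_sub_torsion]), whence
    [T(A_n)] is contained in [T(K)]. *)

Set Implicit Arguments.
Unset Strict Implicit.
Unset Printing Implicit Defensive.

Import GRing.Theory.
Local Open Scope classical_set_scope.
Local Open Scope ring_scope.

(** Full invariance: this is what makes right multiplication by a fixed [g]
    preserve the neighborhoods [T(A_n)], which are a priori only left
    ideals. *)
Lemma torsion_endo (A : zmodType) (m : nat) (f : endo A) (a : A) :
  torsion A m a -> torsion A m (f a).
Proof.
rewrite /torsion /= => am0.
rewrite -(raddfMn (f : {additive A -> A})) am0.
by rewrite (raddf0 (f : {additive A -> A})).
Qed.

Lemma torsion_expn_sub (A : zmodType) (p m n : nat) :
  (m <= n)%N -> torsion A (p ^ m) `<=` torsion A (p ^ n).
Proof.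
move=> mn a; rewrite /torsion /= -(subnKC mn) expnD mulrnA => ->.
by rewrite mul0rn.
Qed.

(** Each element is killed by some power of [p], and the [A_n] are nested, so
    the largest of finitely many exponents works for all of [K]. *)
Lemma finite_sub_torsion (p : nat) (A : zmodType) (K : set A) :
  p_group p A -> finite_set K -> exists n, K `<=` torsion A (p ^ n).
Proof.
move=> hA /finite_seqP[s ->{K}]; elim: s => [|a s [n sn]]; first by exists 0%N.
have [m am] := hA a; exists (maxn m n) => b /=.
rewrite inE => /orP[/eqP->|bs].
  exact: (torsion_expn_sub (leq_maxl m n)).
by apply: (torsion_expn_sub (leq_maxr m n)); apply: sn.
Qed.

Lemma liebert_ring_topology (p : nat) (A : zmodType) :
  ring_topology (liebert_topology p A).
Proof.
pose V (n : nat) (f : endo A) := [set g | annihilator (torsion A (p ^ n)) (g - f)].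
have nbhsV n f : @nbhs _ (Topological.Pack (liebert_topology p A)) f (V n f).
  by exists n.
split.
- move=> [f g] U [n _ nU]; exists (V n f, V n g); first by split; apply: nbhsV.
  move=> [f' g'] [/= ff' gg']; apply: nU => a an.
  have -> : f' + g' - (f + g) = (f' - f) + (g' - g) by rewrite opprD addrACA.
  by rewrite endoDE ff'// gg'// addr0.
- move=> f U [n _ nU]; exists n => // g gf; apply: nU => a an.
  have -> : - g - - f = - (g - f) by rewrite opprD.
  by rewrite endoNE gf// oppr0.
- move=> [f g] U [n _ nU]; exists (V n f, V n g); first by split; apply: nbhsV.
  move=> [f' g'] [/= ff' gg']; apply: nU => a an.
  (* Split so that the increment of [f] is applied to [g a], where [g] is fixed. *)
  have -> : f' * g' - f * g = f' * (g' - g) + (f' - f) * g.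
    by rewrite mulrBr mulrBl subrKA.
  have f'0 : (f' : endo A) 0 = 0 by exact: (raddf0 (f' : {additive A -> A})).
  rewrite endoDE !endoME gg'// f'0 add0r.
  by apply: ff'; apply: torsion_endo.
Qed.

Lemma liebert_finer_finite (p : nat) (A : zmodType) :
  p_group p A -> finer_topology (liebert_topology p A) (finite_topology A).
Proof.
move=> hA U; rewrite /finer_topology !openE => Uo f Uf.
have [K Kfin KU] := Uo f Uf; have [n Kn] := finite_sub_torsion hA Kfin.
by exists n => // g gf; apply: KU => a Ka; apply: gf; apply: Kn.
Qed.

Theorem proposition4 (p : nat) (A : zmodType) (hp : prime p)
  (hA : p_group p A) : admissible (liebert_topology p A).
Proof.
by split; [exact: liebert_ring_topology | exact: liebert_finer_finite].
Qed.
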